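(* Let $X_n$, $n\in\omega$, be pointed topological spaces such that each $X_n$ has the strong Pytkeev$^*$ property at its distinguished point $*_{X_n}$. Then the Tychonoff bouquet $\coprod_{n\in\omega}X_n$ and the Tychonoff product $\prod_{n\in\omega}X_n$ both have the strong Pytkeev$^*$ property at their distinguished point $( *_{X_n})_{n\in\omega}$.
   Context: A sequence $(x_n)_{n\in\omega}$ in a topological space $Z$ accumulates at $z\in Z$ if each neighborhood of $z$ contains $x_n$ for infinitely many indices $n\in\omega$. A family $\mathcal N$ of subsets of $Z$ is a Pytkeev$^*$ network at $z\in Z$ if for each neighborhood $O_z$ of $z$ and each sequence $(x_n)_{n\in\omega}\in Z^\omega$ accumulating at $z$ there is $N\in\mathcal N$ such that $z\in N\subset O_z$ and $N$ contains $x_n$ for infinitely many $n$. The space $Z$ has the strong Pytkeev$^*$ property at $z$ if $Z$ has a countable (i.e. at most countable) Pytkeev$^*$ network at $z$. A pointed space is a topological space $X$ with a distinguished point $*_X$. The Tychonoff product of pointed spaces $X_\alpha$, $\alpha\in A$, is $\prod_{\alpha\in A}X_\alpha$ with the product topology and distinguished point $( *_{X_\alpha})_{\alpha\in A}$. The Tychonoff bouquet is the subspace $$\coprod_{\alpha\in A}X_\alpha=\Big\{(x_\alpha)_{\alpha\in A}\in\prod_{\alpha\in A}X_\alpha:\big|\{\alpha\in A:x_\alpha\neq *_{X_\alpha}\}\big|\le 1\Big\}$$ of the Tychonoff product (here $\coprod$ does not denote the disjoint union), with the same distinguished point. *)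

(* Defs.v *)
From HB Require Import structures.
From mathcomp Require Import all_boot.
From mathcomp Require Import all_classical.
From mathcomp Require Import topology.

Set Implicit Arguments.
Unset Strict Implicit.
Unset Printing Implicit Defensive.

Local Open Scope classical_set_scope.
Local Open Scope card_scope.

Definition accumulation_point (Z : topologicalType) (x : nat -> Z) (z : Z) : Prop :=
  forall O : set Z, nbhs z O -> infinite_set [set n | O (x n)].

Definition Pytkeev_star_network (Z : topologicalType) (z : Z)
    (N : set (set Z)) : Prop :=
  forall (O : set Z) (x : nat -> Z), nbhs z O -> accumulation_point x z ->
  exists S : set Z,
    [/\ N S, S z, S `<=` O & infinite_set [set n | S (x n)]].

Definition strong_Pytkeev_star (Z : topologicalType) (z : Z) : Prop :=
  exists N : set (set Z), countable N /\ Pytkeev_star_network z N.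

(* [prod_topology] is an alias of the dependent product that hides the library's
   pointed structure, whose point is [fun=> point]. *)
HB.instance Definition _ (A : Type) (X : A -> ptopologicalType) :=
  isPointed.Build (prod_topology X) (fun=> point).

Definition bouquet_set (A : Type) (X : A -> ptopologicalType) :
    set (prod_topology X) :=
  [set x | [set a | x a <> point] #<= `I_1].

Arguments bouquet_set {A} X _.

Lemma bouquet_point (A : Type) (X : A -> ptopologicalType) :
  (point : prod_topology X) \in bouquet_set X.
Proof.
rewrite inE /bouquet_set /=.
have -> : [set a | (point : prod_topology X) a <> point] = set0.
  by apply/seteqP; split => a //=; apply.
exact: card_ge0.
Qed.

(* [set_type] carries the topology induced by the inclusion, unlike [subspace],
   whose carrier is the whole ambient space. *)
Definition Tychonoff_bouquet (A : Type) (X : A -> ptopologicalType) : Type :=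
  set_type (bouquet_set X).

HB.instance Definition _ (A : Type) (X : A -> ptopologicalType) :=
  Topological.copy (Tychonoff_bouquet X) (set_type (bouquet_set X)).

HB.instance Definition _ (A : Type) (X : A -> ptopologicalType) :=
  isPointed.Build (Tychonoff_bouquet X) (exist _ point (bouquet_point X)).

(* Main.v *)
Require Import Defs.
From mathcomp Require Import all_boot.
From mathcomp Require Import all_classical.
From mathcomp Require Import topology.

(** The product is the heart of the matter.  A basic neighborhood of the
    distinguished point restricts finitely many coordinates [i <= m], each to a
    neighborhood [U i].  By [exhausting_chains], the network members of [X i]
    lying in [U i] are absorbed, one after the other, by an increasing chain
    [E i j], [j = 0, 1, ...], of finite unions of them.  The boxes
    [\prod_(i <= m) E i j] are taken from a fixed countable family, and one of
    them must contain infinitely many terms of any sequence [x] accumulating at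
    the distinguished point.

    Otherwise every box contains finitely many terms.  For a given [k], let
    [j i] be the first stage at which the chain of the coordinate [i] catches
    [x k i], infinite if there is none: the boxes catch [x k] exactly at the
    largest of these stages, so that some coordinate [i] is a bottleneck for
    [x k], in the sense that [E i j] misses [x k i] whenever the [j]-th box
    misses [x k].  This covers the indices by finitely many classes, one per
    coordinate, and by [accumulation_split] the sequence still accumulates
    along one of them, say that of [i].  So do the [i]-th coordinates, whence
    some [E i j] contains [x k i] for infinitely many [k] in the class; for all
    of them the [j]-th box contains [x k], a contradiction.

    The bouquet is a subspace of the product, and the property is inherited by
    topologies induced by a map ([strong_Pytkeev_star_initial]). *)

Local Open Scope classical_set_scope.
Local Open Scope card_scope.

(** Passing to the indices in [A] replaces passing to a subsequence, which
    would require renumbering. *)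
Definition clusters_along {Z : topologicalType} (A : set nat)
    (x : nat -> Z) (z : Z) : Prop :=
  forall O : set Z, nbhs z O -> infinite_set (A `&` [set n | O (x n)]).

Lemma clusters_along_continuous {Y Z : topologicalType} (f : Y -> Z)
    (A : set nat) (x : nat -> Y) (y : Y) :
  {for y, continuous f} ->
  clusters_along A x y -> clusters_along A (f \o x) (f y).
Proof. by move=> fy xy O /fy /xy. Qed.

(** If the conclusion failed for every class, the intersection of the finitely
    many witnessing neighborhoods would contain finitely many terms. *)
Lemma accumulation_split {Z : topologicalType} {I : finType}
    (A : I -> set nat) (x : nat -> Z) (z : Z) :
  (forall n, exists i, A i n) -> accumulation_point x z ->
  exists i, clusters_along (A i) x z.
Proof.
move=> Acover xz; apply: contrapT => /forallNP noacc.
have /choice[O Oprop] : forall i, exists O : set Z,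
    nbhs z O /\ finite_set (A i `&` [set n | O (x n)]).
  move=> i; have /existsNP[O] := noacc i.
  by move=> /not_implyP[zO /contrapT finO]; exists O.
have zO : nbhs z [set y | forall i, O i y].
  by apply: filter_forall => i; have [] := Oprop i.
apply: (xz _ zO).
apply: (@sub_finite_set _ _
  (\bigcup_(i in [set: I]) (A i `&` [set n | O i (x n)]))).
  move=> n On; have [i Ain] := Acover n.
  by exists i => //; split=> //; exact: On.
by apply: bigcup_finite => [|i _]; [exact: finite_finset|have [] := Oprop i].
Qed.

Lemma infinite_set_enum (A : set nat) : infinite_set A ->
  exists f : nat -> nat, injective f /\ range f = A.
Proof.
move=> Ainf.
have /card_esym/card_set_bijP[f [fA finj fsurj]] : A #= [set: nat].
  apply/card_eqPle; split; first exact: countableP.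
  exact/infiniteP.
exists f; split; first by move=> a b; apply: finj; rewrite inE.
apply/seteqP; split; first by move=> _ [n _ <-]; exact: fA.
exact: fsurj.
Qed.

Lemma Pytkeev_star_network_along {Z : topologicalType} (z : Z)
    (N : set (set Z)) (A : set nat) (O : set Z) (x : nat -> Z) :
  Pytkeev_star_network z N -> nbhs z O -> clusters_along A x z ->
  exists S : set Z,
    [/\ N S, S z, S `<=` O & infinite_set (A `&` [set n | S (x n)])].
Proof.
move=> netN zO xz.
have Ainf : infinite_set A.
  by apply: sub_infinite_set (xz setT filterT) => n [].
have [f [finj fA]] := infinite_set_enum _ Ainf.
have xfz : accumulation_point (x \o f) z.
  move=> V zV finV; apply: (xz V zV).
  apply: sub_finite_set (finite_image f finV) => n [].
  by rewrite -fA => -[k _ <-] Vxk; exists k.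
have [S [NS Sz SO Sinf]] := netN O _ zO xfz; exists S; split => // finS.
apply: Sinf; apply: (@sub_finite_set _ _ (f @^-1` (A `&` [set n | S (x n)]))).
  by move=> n Sn; split=> //; rewrite -fA; exists n.
by apply: finite_preimage => // a b _ _; exact: finj.
Qed.

(** In a product, single network members for the different coordinates cannot
    be chosen for a common set of indices; growing finite unions can be compared
    by their stage instead.  The union [E t] consists of [z] and of the members
    whose codes are listed in [t], so that [E] is a countable family that does
    not depend on [O], and [z] belongs to [E t] even when [t] is empty. *)
Lemma exhausting_chains {Z : topologicalType} (z : Z) :
  strong_Pytkeev_star z ->
  exists E : seq nat -> set Z, (forall t, E t z) /\
  forall O : set Z, nbhs z O -> exists s : nat -> seq nat,
    [/\ forall j, E (s j) `<=` O,
        forall i j, (i <= j)%N -> E (s i) `<=` E (s j) &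
        forall (A : set nat) (x : nat -> Z), clusters_along A x z ->
        exists j, infinite_set (A `&` [set n | E (s j) (x n)])].
Proof.
move=> [N [/countable_injP[g ginj] netN]].
exists (fun t => z |` \bigcup_(S in [set S | N S /\ g S \in t]) S).
split=> [t|O zO]; first by left.
pose good n := `[< exists S, [/\ N S, S z, S `<=` O & g S = n] >].
exists (fun j => [seq n <- iota 0 j.+1 | good n]); split.
- move=> j y [->|[S [NS gS] Sy]]; first exact: nbhs_singleton.
  move: gS; rewrite mem_filter => /andP[/asboolP[S' [NS' _ S'O gS']] _].
  by apply: S'O; rewrite (ginj S' S) ?inE.
- move=> i j ij y [->|[S [NS gS] Sy]]; first by left.
  move: gS; rewrite mem_filter mem_iota => /andP[goodS /andP[_ ltS]].
  right; exists S => //; split=> //; rewrite mem_filter mem_iota goodS /=.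
  by apply: leq_trans ltS _; rewrite !add0n ltnS.
- move=> A x xz.
  have [S [NS Sz SO Sinf]] := Pytkeev_star_network_along _ _ _ _ _ netN zO xz.
  exists (g S); apply: sub_infinite_set Sinf => n [An Sn]; split=> //.
  right; exists S => //; split=> //.
  rewrite mem_filter mem_iota add0n ltnS leqnn !andbT.
  by apply/asboolP; exists S.
Qed.

Lemma nbhs_prod_box {X : nat -> topologicalType} (p : prod_topology X)
    (O : set (prod_topology X)) : nbhs p O ->
  exists m (U : forall i, set (X i)), (forall i, nbhs (p i) (U i)) /\
    [set x | forall i, (i <= m)%N -> U i (x i)] `<=` O.
Proof.
pose D := [set U : nat * (forall i, set (X i)) | forall i, nbhs (p i) (U.2 i)].
pose box (U : nat * (forall i, set (X i))) : set (prod_topology X) :=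
  [set x | forall i, (i <= U.1)%N -> U.2 i (x i)].
(* The sets containing a box form a filter, so that comparing it with the
   neighborhoods of [p] can be done one coordinate at a time. *)
have boxF : Filter (filter_from D box).
  apply: filter_from_filter.
    by exists (0%N, fun=> setT) => i; exact: filterT.
  move=> [m U] [n V] DU DV; exists (maxn m n, fun i => U i `&` V i).
    by move=> i; exact: filterI.
  move=> x xUV; split=> i le_i; have [] // := xUV i.
    by apply: leq_trans le_i _; exact: leq_maxl.
  by apply: leq_trans le_i _; exact: leq_maxr.
have boxp : filter_from D box --> p.
  apply/cvg_sup => i V /= [_ [[W Wop <-] Wp WV]].
  (* [U] is [W] at the coordinate [i] and the whole space elsewhere. *)
  pose U j := [set y : X j | forall e : j = i, W (ecast k (X k) e y)].
  exists (i, U) => [j|x xU]; last by apply: WV; exact: xU i (leqnn i) erefl.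
  have [e|ji] := eqVneq j i; last first.
    by apply: filterS filterT => y _ e; rewrite e eqxx in ji.
  rewrite {}e; apply: (@filterS _ _ _ W) => [y Wy e|].
    by rewrite eq_axiomK.
  exact: open_nbhs_nbhs.
by move=> /boxp[[m U] DU boxU]; exists m, U.
Qed.

Lemma exists_dfun {I : Type} (T : I -> Type) (P : forall i, T i -> Prop) :
  (forall i, exists y, P i y) -> exists f : forall i, T i, forall i, P i (f i).
Proof.
by move=> PT; exists (fun i => projT1 (cid (PT i))) => i; exact: projT2.
Qed.

Lemma strong_Pytkeev_star_prod {X : nat -> topologicalType}
    (p : prod_topology X) :
  (forall i, strong_Pytkeev_star (p i)) -> strong_Pytkeev_star p.
Proof.
move=> Xp.
have [E Echain] := exists_dfun _ _ (fun i => exhausting_chains _ (Xp i)).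
pose box (c : seq (seq nat)) : set (prod_topology X) :=
  [set x | forall i, (i < size c)%N -> E i (nth [::] c i) (x i)].
exists (range box); split.
  exact: sub_countable (card_image_le _ _) (countableP _).
move=> O x /nbhs_prod_box[m [U [pU UO]]] xp.
have [s schain] := exists_dfun _ _ (fun i => (Echain i).2 (U i) (pU i)).
pose B j := box (mkseq (fun i => s i j) m.+1).
have BE j y : B j y <-> forall i : 'I_m.+1, E i (s i j) (y i).
  split=> [By i|Ey i]; last first.
    by rewrite size_mkseq => im; rewrite nth_mkseq //; exact: (Ey (Ordinal im)).
  by have := By i; rewrite size_mkseq nth_mkseq //; apply.
suff [j Binf] : exists j, infinite_set [set n | B j (x n)].
  exists (B j); split=> //.
  - by apply/BE => i; exact: (Echain i).1.
  - move=> y /BE Ey; apply: UO => i im.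
    have [sU _ _] := schain i; apply: (sU j).
    exact: (Ey (Ordinal (im : (i < m.+1)%N))).
apply: contrapT => /forallNP Bfin.
(* The indices [n] for which the coordinate [i] is a bottleneck: the chain of
   [i] catches [x n i] no earlier than the boxes catch [x n]. *)
pose A (i : 'I_m.+1) := [set n | forall j, E i (s i j) (x n i) -> B j (x n)].
have Acover n : exists i, A i n.
  apply: contrapT => /forallNP notA.
  have /choice[j jprop] : forall i : 'I_m.+1, exists j,
      E i (s i j) (x n i) /\ ~ B j (x n).
    by move=> i; have /existsNP[j] := notA i; move=> /not_implyP; exists j.
  (* The maximum is attained because there is at least one coordinate. *)
  have [|i jmax] := @eq_bigmax 'I_m.+1 j; first by rewrite card_ord.
  have [_ notB] := jprop i; apply: notB; apply/BE => k.
  have [_ mono _] := schain k; have [Ek _] := jprop k.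
  by apply: mono Ek; rewrite -jmax; exact: leq_bigmax.
have [i accA] := accumulation_split A _ _ Acover xp.
have accAi : clusters_along (A i) (fun n => x n i) (p i).
  apply: (clusters_along_continuous (fun y : prod_topology X => y i)) accA.
  exact: proj_continuous.
have [_ _ /(_ _ _ accAi)[j Einf]] := schain i.
apply: (Bfin j); apply: sub_infinite_set Einf => n [An En].
exact: An.
Qed.

(** Preimages of network members form a network, since every neighborhood
    contains the preimage of one and [f] preserves accumulation. *)
Lemma strong_Pytkeev_star_initial {Y Z : topologicalType} (f : Y -> Z) (y : Y) :
  {for y, continuous f} ->
  (forall O, nbhs y O -> exists2 V, nbhs (f y) V & f @^-1` V `<=` O) ->
  strong_Pytkeev_star (f y) -> strong_Pytkeev_star y.
Proof.
move=> fy yf [N [cN netN]]; exists [set f @^-1` S | S in N]; split.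
  exact: sub_countable (card_image_le _ _) cN.
move=> O x /yf[V fyV VO] xy.
have [|S [NS Sfy SV Sinf]] := netN V (f \o x) fyV.
  by move=> W /fy /xy.
exists (f @^-1` S); split=> //; first by exists S.
by apply: subset_trans VO => ? /SV.
Qed.

Theorem theorem6p5 (X : nat -> ptopologicalType)
    (hX : forall n : nat, strong_Pytkeev_star (point : X n)) :
  strong_Pytkeev_star (point : Tychonoff_bouquet X) /\
  strong_Pytkeev_star (point : prod_topology X).
Proof.
have prodX : strong_Pytkeev_star (point : prod_topology X).
  exact: strong_Pytkeev_star_prod.
split=> //.
apply: (@strong_Pytkeev_star_initial (Tychonoff_bouquet X) (prod_topology X)
  set_val) => //.
- exact: initial_continuous.
- move=> O [_ [[V Vop <-] Vp VO]]; exists V => //.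
  exact: open_nbhs_nbhs.
Qed.
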